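(* Let $q\ge1$, $N\in\mathbb{N}$. Suppose that at each frequency $\omega\in\Omega_M$ the systems $P_1$ and $P_2$ have given nominal models $\overline P_1(j\omega),\overline P_2(j\omega)\in\mathbb{C}$, and let $\overline R_\ell(\omega):=\phi^{-1}(\overline P_\ell(j\omega))$, $\ell=1,2$. Let the distribution characterising the uncertainty of system $\ell\in\{1,2\}$ on the Riemann sphere at $\omega\in\Omega_M$ be the empirical distribution $$\mathbb{P}_{R_\ell(\omega)}=\frac1N\sum_{i=1}^N\boldsymbol{\delta}_{R_\ell^{(i)}(j\omega)},$$ with $R_\ell^{(i)}(j\omega)\in\partial\mathfrak{R}$. For $i,k\in\{1,\dots,N\}$ define $$\Delta_{\mathrm{nom}}^{(ik)}(\omega):=\mathrm{d_{chord}}\left(R_1^{(i)}(j\omega),\overline R_1(\omega)\right)+\mathrm{d_{chord}}\left(R_2^{(k)}(j\omega),\overline R_2(\omega)\right),$$ and for a joint distribution $\pi_\omega\in\Pi_\omega=\Pi(\mathbb{P}_{R_1(\omega)},\mathbb{P}_{R_2(\omega)})$ define $$\Delta_{\mathrm{dev}}(\omega)=\mathrm{d_{chord}}(\overline R_1(\omega),\overline R_2(\omega))-\sum_{i=1}^N\sum_{k=1}^N\Delta_{\mathrm{nom}}^{(ik)}(\omega)\,\pi_\omega(i,k).$$ Then $$\hat d_q(P_1,P_2)\ \ge\ \max_{\omega\in\Omega_M}\ \inf_{\pi_\omega\in\Pi_\omega}\left(\Delta_{\mathrm{dev}}(\omega)\right)_+^q.$$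
   Context: $(x)_+^q=(\max(0,x))^q$. $\Omega=[0,\infty)$ and $\Omega_M=\{\omega_i\in\Omega\}_{i=1}^M$ is a finite set of $M\in\mathbb{N}$ frequencies. The Riemann sphere is $\partial\mathfrak{R} = \{(x,y,z)\in\mathbb{R}^3 : x^2+y^2+(z-\tfrac12)^2=\tfrac14\}$. The inverse stereographic projection $\phi^{-1}:\mathbb{C}\to\partial\mathfrak{R}$ is $$\phi^{-1}(c) = \left(\frac{\mathrm{Re}(c)}{1+|c|^2},\frac{\mathrm{Im}(c)}{1+|c|^2},\frac{|c|^2}{1+|c|^2}\right),$$ and the chordal distance on $\partial\mathfrak{R}$ is $\mathrm{d_{chord}}(r_1,r_2)=\|r_1-r_2\|$ (Euclidean norm in $\mathbb{R}^3$). $\boldsymbol{\delta}_r$ is the Dirac measure at $r$. A joint distribution of the two empirical distributions at frequency $\omega$ is described by a nonnegative $N\times N$ array $\pi_\omega(i,k)$ over pairs of samples, all of whose row sums and column sums equal $1/N$; $\Pi_\omega$ is the set of these. The (frequency-discretised) empirical type-$q$ distance is $$\hat d_q(P_1,P_2):=\max_{\omega\in\Omega_M}\ \inf_{\pi_\omega\in\Pi_\omega}\ \sum_{i=1}^N\sum_{k=1}^N\mathrm{d_{chord}}\left(R_1^{(i)}(j\omega),R_2^{(k)}(j\omega)\right)^q\pi_\omega(i,k).$$ *)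

(* Defs.v *)
(* MathComp / MathComp-Analysis *)
From HB Require Import structures.
From mathcomp Require Import all_boot all_order all_algebra.
From mathcomp Require Import all_classical all_reals all_analysis.
From mathcomp Require Import complex.

Set Implicit Arguments.
Unset Strict Implicit.
Unset Printing Implicit Defensive.

Import Order.TTheory GRing.Theory Num.Theory.

Local Open Scope classical_set_scope.
Local Open Scope ring_scope.

(* The canonical norm on 'rV[R]_3 is the sup norm, hence this definition. *)
Definition euclidean_norm (R : realType) (n : nat) (u : 'rV[R]_n) : R :=
  Num.sqrt (\sum_(i < n) u ord0 i ^+ 2).

Definition row3 (R : realType) (x y z : R) : 'rV[R]_3 :=
  \row_(i < 3) [:: x; y; z]`_i.

Definition riemann_sphere (R : realType) : set 'rV[R]_3 :=
  [set r | exists x y z : R,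
     r = row3 x y z /\ x ^+ 2 + y ^+ 2 + (z - 1 / 2) ^+ 2 = 1 / 4].

(* [Normc.normc] is the R-valued modulus; the generic norm `|c| is
   R[i]-valued. *)
Definition inv_stereo (R : realType) (c : R[i]) : 'rV[R]_3 :=
  let m2 := Normc.normc c ^+ 2 in
  row3 (complex.Re c / (1 + m2)) (complex.Im c / (1 + m2)) (m2 / (1 + m2)).

Definition dchord (R : realType) (r1 r2 : 'rV[R]_3) : R :=
  euclidean_norm (r1 - r2).

(* Joint distributions of two empirical distributions with N samples each,
   as arrays of weights on pairs of sample indices; samples may coincide, and
   the set does not depend on their values. *)
Definition couplings (R : realType) (N : nat) : set 'M[R]_N :=
  [set p : 'M[R]_N | [/\ forall i k, 0 <= p i k,
               forall i, \sum_(k < N) p i k = 1 / N%:R &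
               forall k, \sum_(i < N) p i k = 1 / N%:R]].
Arguments couplings : clear implicits.

(* The index set is nonempty, so the seed F (Ordinal hM) is one of the values
   and this is their maximum, with no default value involved. *)
Definition max_ord (R : realType) (M : nat) (hM : (0 < M)%N) (F : 'I_M -> R)
    : R :=
  \big[Num.max/F (Ordinal hM)]_(m < M) F m.

(* (x)_+^q = (max(0, x))^q, with a real exponent q. *)
Definition pos_powR (R : realType) (x q : R) : R := Num.max 0 x `^ q.

(* In what follows S1 i w and S2 k w are the samples R_1^(i)(jw) and
   R_2^(k)(jw), and Rbar1 w and Rbar2 w the nominal points: frequency responses
   are functions of the real frequency w. *)

Definition emp_dist (R : realType) (q : R) (N M : nat) (hM : (0 < M)%N)
    (omega : 'I_M -> R) (S1 S2 : 'I_N -> R -> 'rV[R]_3) : R :=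
  max_ord hM (fun m =>
    inf [set \sum_(i < N) \sum_(k < N)
               dchord (S1 i (omega m)) (S2 k (omega m)) `^ q * p i k
        | p in couplings R N]).

Definition Delta_nom (R : realType) (N : nat)
    (S1 S2 : 'I_N -> R -> 'rV[R]_3) (Rbar1 Rbar2 : R -> 'rV[R]_3)
    (i k : 'I_N) (w : R) : R :=
  dchord (S1 i w) (Rbar1 w) + dchord (S2 k w) (Rbar2 w).

Definition Delta_dev (R : realType) (N : nat)
    (S1 S2 : 'I_N -> R -> 'rV[R]_3) (Rbar1 Rbar2 : R -> 'rV[R]_3)
    (p : 'M[R]_N) (w : R) : R :=
  dchord (Rbar1 w) (Rbar2 w)
  - \sum_(i < N) \sum_(k < N) Delta_nom S1 S2 Rbar1 Rbar2 i k w * p i k.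

(* Main.v *)
Require Import Defs.
From HB Require Import structures.
From mathcomp Require Import all_boot all_order all_algebra.
From mathcomp Require Import all_classical all_reals all_analysis.
From mathcomp Require Import complex.
From mathcomp Require Import ring lra.

Set Implicit Arguments.
Unset Strict Implicit.
Unset Printing Implicit Defensive.

Import Order.TTheory GRing.Theory Num.Theory.

Local Open Scope classical_set_scope.
Local Open Scope ring_scope.

(** The argument is pointwise in the frequency and in the coupling. Fix both.
    The triangle inequality for the chordal distance, through the two nominal
    points, gives for all samples
      dchord Rbar1 Rbar2 - Delta_nom i k <= dchord (S1 i) (S2 k).
    A coupling p has total mass 1, so averaging over p yields
      Delta_dev p <= sum_(i,k) dchord (S1 i) (S2 k) * p i k
    ([Delta_dev_le_mean]). The right-hand side is nonnegative, so it also
    dominates the positive part, and Jensen's inequality for the convex map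
    x |-> x^q ([jensen_powR]) bounds its q-th power by the transport cost of p.
    Infima over couplings and the maximum over frequencies are monotone.

    The only geometric input is the triangle inequality of the ambient
    Euclidean space, obtained from the Cauchy-Schwarz inequality
    ([euclidean_normD]). *)

(** Lagrange's identity: twice the difference of the two sides is the sum over
    i, j of (u i * v j - u j * v i)^2. *)
Lemma cauchy_schwarz_sum (R : realType) (I : finType) (u v : I -> R) :
  (\sum_i u i * v i) ^+ 2 <= (\sum_i u i ^+ 2) * (\sum_i v i ^+ 2).
Proof.
suff lagrange : \sum_i \sum_j (u i * v j - u j * v i) ^+ 2 =
    2 * ((\sum_i u i ^+ 2) * (\sum_i v i ^+ 2) - (\sum_i u i * v i) ^+ 2).
  rewrite -subr_ge0 -(pmulr_rge0 _ (ltr0n R 2)) -lagrange.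
  by apply: sumr_ge0 => i _; apply: sumr_ge0 => j _; exact: sqr_ge0.
rewrite [2 * _](_ : _ = (\sum_i u i ^+ 2) * (\sum_j v j ^+ 2) +
   (\sum_i v i ^+ 2) * (\sum_j u j ^+ 2) -
   2 * ((\sum_i u i * v i) * (\sum_j u j * v j))); last by ring.
rewrite !big_distrlr /= mulr_sumr -big_split -sumrB; apply: eq_bigr => i _.
rewrite mulr_sumr -big_split -sumrB; apply: eq_bigr => j _ /=.
by ring.
Qed.

Lemma euclidean_normD (R : realType) (n : nat) (u v : 'rV[R]_n) :
  euclidean_norm (u + v) <= euclidean_norm u + euclidean_norm v.
Proof.
have sq_ge0 (w : 'rV[R]_n) : 0 <= \sum_i w ord0 i ^+ 2.
  by apply: sumr_ge0 => i _; exact: sqr_ge0.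
have dot_le : \sum_i u ord0 i * v ord0 i
    <= euclidean_norm u * euclidean_norm v.
  rewrite -sqrtrM; last exact: sq_ge0.
  apply: (le_trans (ler_norm _)).
  by rewrite -sqrtr_sqr ler_sqrt ?mulr_ge0 //; exact: cauchy_schwarz_sum.
have expand : \sum_i (u + v) ord0 i ^+ 2 = euclidean_norm u ^+ 2 +
    2 * (\sum_i u ord0 i * v ord0 i) + euclidean_norm v ^+ 2.
  rewrite !sqr_sqrtr // mulr_sumr -!big_split; apply: eq_bigr => i _ /=.
  by rewrite mxE; ring.
rewrite {1}/euclidean_norm expand.
rewrite -[leRHS]ger0_norm ?addr_ge0 ?sqrtr_ge0 // -sqrtr_sqr.
by rewrite ler_sqrt ?sqr_ge0 //; lra.
Qed.

Lemma dchord_ge0 (R : realType) (x y : 'rV[R]_3) : 0 <= dchord x y.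
Proof. exact: sqrtr_ge0. Qed.

Lemma dchordC (R : realType) (x y : 'rV[R]_3) : dchord x y = dchord y x.
Proof.
congr (Num.sqrt _); apply: eq_bigr => i _.
by rewrite !mxE -sqrrN opprB.
Qed.

Lemma dchord_triangle (R : realType) (y x z : 'rV[R]_3) :
  dchord x z <= dchord x y + dchord y z.
Proof.
rewrite /dchord [x - z](_ : _ = (x - y) + (y - z)); last first.
  by rewrite addrA subrK.
exact: euclidean_normD.
Qed.

(** The graph of x |-> x^q lies above its tangent at m; this is Young's
    inequality for a and m^(q-1) with the conjugate exponents q and q/(q-1). *)
Lemma powR_tangent (R : realType) (q a m : R) : 1 <= q -> 0 <= a -> 0 <= m ->
  q * (a * m `^ (q - 1)) <= a `^ q + (q - 1) * m `^ q.
Proof.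
rewrite le_eqVlt => /predU1P[<- a0 m0|q1 a0 m0].
  by rewrite subrr powRr0 powRr1 // mul0r !(mulr1, mul1r) addr0.
have q0 : 0 < q by apply: lt_trans q1.
have q10 : 0 < q - 1 by rewrite subr_gt0.
have conj_exp : q^-1 + (q / (q - 1))^-1 = 1.
  by field; rewrite (gt_eqF q0) (gt_eqF q10).
have := conjugate_powR a0 (powR_ge0 m (q - 1)) q0 (divr_gt0 q0 q10) conj_exp.
rewrite -powRrM [(q - 1) * _]mulrC divfK ?gt_eqF // => young.
rewrite [leRHS](_ : _ = q * (a `^ q / q + m `^ q / (q / (q - 1)))).
  by rewrite ler_pM2l.
by field; rewrite (gt_eqF q0) (gt_eqF q10).
Qed.

(** Average the tangent inequality at the mean of a: the linear terms
    collapse because the weights sum to 1. *)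
Lemma jensen_powR (R : realType) (I : finType) (q : R) (w a : I -> R) :
  1 <= q -> (forall i, 0 <= w i) -> \sum_i w i = 1 -> (forall i, 0 <= a i) ->
  (\sum_i a i * w i) `^ q <= \sum_i a i `^ q * w i.
Proof.
move=> q1 w0 w1 a0; set m := \sum_i a i * w i.
have m0 : 0 <= m by apply: sumr_ge0 => i _; rewrite mulr_ge0.
have : \sum_i q * (a i * m `^ (q - 1)) * w i <=
       \sum_i (a i `^ q + (q - 1) * m `^ q) * w i.
  by apply: ler_sum => i _; rewrite ler_wpM2r // powR_tangent.
have -> : \sum_i q * (a i * m `^ (q - 1)) * w i = q * m `^ q.
  rewrite -(mulr_powRB1 m0 (lt_le_trans ltr01 q1)).
  rewrite {2}/m mulr_suml mulr_sumr; apply: eq_bigr => i _.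
  by ring.
have -> : \sum_i (a i `^ q + (q - 1) * m `^ q) * w i =
          \sum_i a i `^ q * w i + (q - 1) * m `^ q.
  rewrite -[X in _ = _ + X]mulr1 -w1 mulr_sumr -big_split.
  by apply: eq_bigr => i _; rewrite mulrDl.
lra.
Qed.

Lemma couplings_sum1 (R : realType) (N : nat) (p : 'M[R]_N) : (0 < N)%N ->
  couplings R N p -> \sum_i \sum_k p i k = 1.
Proof.
move=> hN [_ row_sum _].
under eq_bigr do rewrite row_sum.
by rewrite sumr_const card_ord -[LHS]mulr_natl mul1r divff // pnatr_eq0 -lt0n.
Qed.

(** The product coupling; without a point in the set of couplings the infima
    would take their default value. *)
Lemma couplings_nonempty (R : realType) (N : nat) : (0 < N)%N ->
  couplings R N !=set0.
Proof.
move=> hN; have N0 : N%:R != 0 :> R by rewrite pnatr_eq0 -lt0n.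
exists (const_mx (N%:R^-1 ^+ 2)); split=> [i k|i|k].
- by rewrite mxE exprn_ge0 // invr_ge0 ler0n.
- under eq_bigr do rewrite mxE.
  by rewrite sumr_const card_ord -[LHS]mulr_natl; field.
- under eq_bigr do rewrite mxE.
  by rewrite sumr_const card_ord -[LHS]mulr_natl; field.
Qed.

Lemma jensen_coupling (R : realType) (N : nat) (q : R) (p a : 'M[R]_N) :
  (0 < N)%N -> 1 <= q -> couplings R N p -> (forall i k, 0 <= a i k) ->
  (\sum_i \sum_k a i k * p i k) `^ q <= \sum_i \sum_k a i k `^ q * p i k.
Proof.
move=> hN q1 cp a0; have p1 := couplings_sum1 hN cp.
case: cp => p0 _ _; rewrite !pair_bigA in p1 *.
exact: (@jensen_powR _ _ q (fun ik => p ik.1 ik.2) (fun ik => a ik.1 ik.2)).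
Qed.

Lemma Delta_dev_le_mean (R : realType) (N : nat)
    (S1 S2 : 'I_N -> R -> 'rV[R]_3) (Rbar1 Rbar2 : R -> 'rV[R]_3)
    (p : 'M[R]_N) (w : R) : (0 < N)%N -> couplings R N p ->
  Delta_dev S1 S2 Rbar1 Rbar2 p w <=
  \sum_i \sum_k dchord (S1 i w) (S2 k w) * p i k.
Proof.
move=> hN cp; rewrite /Delta_dev lerBlDr.
rewrite -[leLHS]mulr1 -(couplings_sum1 hN cp) mulr_sumr -big_split.
apply: ler_sum => i _; rewrite mulr_sumr -big_split.
apply: ler_sum => k _ /=; rewrite -mulrDl ler_wpM2r //; first by case: cp.
rewrite /Delta_nom (dchordC (S1 i w) (Rbar1 w)).
have := dchord_triangle (S1 i w) (Rbar1 w) (Rbar2 w).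
have := dchord_triangle (S2 k w) (S1 i w) (Rbar2 w).
lra.
Qed.

Lemma pos_powR_Delta_dev_le (R : realType) (q : R) (N : nat)
    (S1 S2 : 'I_N -> R -> 'rV[R]_3) (Rbar1 Rbar2 : R -> 'rV[R]_3)
    (p : 'M[R]_N) (w : R) : 1 <= q -> (0 < N)%N -> couplings R N p ->
  pos_powR (Delta_dev S1 S2 Rbar1 Rbar2 p w) q <=
  \sum_i \sum_k dchord (S1 i w) (S2 k w) `^ q * p i k.
Proof.
move=> q1 hN cp; pose D := \matrix_(i, k) dchord (S1 i w) (S2 k w).
have mean_ge0 : 0 <= \sum_i \sum_k dchord (S1 i w) (S2 k w) * p i k.
  apply: sumr_ge0 => i _; apply: sumr_ge0 => k _.
  by rewrite mulr_ge0 ?dchord_ge0 //; case: cp.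
apply: (@le_trans _ _ ((\sum_i \sum_k dchord (S1 i w) (S2 k w) * p i k) `^ q)).
  apply: ge0_ler_powR; first exact: le_trans ler01 q1.
  - by rewrite nnegrE le_max lexx.
  - by rewrite nnegrE.
  by rewrite ge_max mean_ge0 Delta_dev_le_mean.
have D_ge0 i k : 0 <= D i k by rewrite mxE dchord_ge0.
have := jensen_coupling hN q1 cp D_ge0.
have -> : \sum_i \sum_k D i k * p i k =
          \sum_i \sum_k dchord (S1 i w) (S2 k w) * p i k.
  by apply: eq_bigr => i _; apply: eq_bigr => k _; rewrite mxE.
have -> // : \sum_i \sum_k D i k `^ q * p i k =
             \sum_i \sum_k dchord (S1 i w) (S2 k w) `^ q * p i k.
by apply: eq_bigr => i _; apply: eq_bigr => k _; rewrite mxE.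
Qed.

(** Nonnegativity of f supplies the lower bound that makes the first infimum
    a genuine one. *)
Lemma le_inf_image (R : realType) (T : Type) (A : set T) (f g : T -> R) :
  A !=set0 -> (forall x, A x -> 0 <= f x <= g x) ->
  inf [set f x | x in A] <= inf [set g x | x in A].
Proof.
move=> [x0 Ax0] fg; apply: lb_le_inf; first by exists (g x0), x0.
move=> _ [x Ax <-]; have /andP[_] := fg x Ax; apply: le_trans.
apply: ge_inf; last by exists x.
by exists 0 => _ [y Ay <-]; have /andP[] := fg y Ay.
Qed.

Lemma le_max_ord (R : realType) (M : nat) (hM : (0 < M)%N) (F G : 'I_M -> R) :
  (forall m, F m <= G m) -> max_ord hM F <= max_ord hM G.
Proof.
move=> FG.
have F_le m : F m <= max_ord hM G by apply: (le_trans (FG m)); exact: le_bigmax.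
exact: bigmax_le.
Qed.

Theorem mainTheorem4 (R : realType) (q : R) (hq : 1 <= q)
  (N : nat) (hN : (0 < N)%N)
  (M : nat) (hM : (0 < M)%N)
  (omega : 'I_M -> R) (omega_inj : injective omega)
  (omega_ge0 : forall m, 0 <= omega m)
  (Pbar1 Pbar2 : R -> R[i])
  (S1 S2 : 'I_N -> R -> 'rV[R]_3)
  (hS1 : forall i m, riemann_sphere (S1 i (omega m)))
  (hS2 : forall k m, riemann_sphere (S2 k (omega m))) :
  let Rbar1 := fun w : R => inv_stereo (Pbar1 w) in
  let Rbar2 := fun w : R => inv_stereo (Pbar2 w) in
  emp_dist q hM omega S1 S2 >=
  max_ord hM (fun m =>
    inf [set pos_powR (Delta_dev S1 S2 Rbar1 Rbar2 p (omega m)) q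
        | p in couplings R N]).
Proof.
cbv zeta; apply: le_max_ord => m.
apply: le_inf_image => [|p cp]; first exact: couplings_nonempty.
by rewrite powR_ge0 pos_powR_Delta_dev_le.
Qed.
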